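(* (ZF, without the Axiom of Choice.) For each uncountable cardinal $\kappa\in On$, both $Free(\kappa\mapsto[\kappa]^{<\omega},\omega)$ and $FreeUnion(\kappa\mapsto[\kappa]^{<\omega},\omega)$ hold.
   Context: The base theory is ZF. Cardinals are initial ordinals. Given a set mapping $F:\kappa\to[\kappa]^{<\mu}$, a set $X\subset\kappa$ is called $F$-free iff $\alpha\notin F(\beta)$ for each $\{\alpha,\beta\}\in[X]^2$ (that is, for any two distinct $\alpha,\beta\in X$). For cardinals $\kappa,\lambda,\mu$: $Free(\kappa\mapsto[\kappa]^{<\mu},\lambda)$ means that for each set mapping $F:\kappa\to[\kappa]^{<\mu}$ there is an $F$-free set $A\subset\kappa$ with $|A|=\lambda$; $FreeUnion(\kappa\mapsto[\kappa]^{<\mu},\lambda)$ means that for each set mapping $F:\kappa\to[\kappa]^{<\mu}$ the set $\kappa$ can be partitioned into $\lambda$-many $F$-free sets. *)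

(* Defs.v *)
Set Implicit Arguments.
Unset Strict Implicit.

(** ZF is treated through its models: a theorem of ZF is a first-order sentence
    that holds in every structure for the language of set theory satisfying the
    ZF axioms.  The two schemata range over first-order formulas with
    parameters only, not over arbitrary predicates of the metatheory, so that a
    choice principle of the metatheory does not make Choice true in the model.
    Every definition below quantifies over elements of the structure only. *)

Record set_structure : Type := SetStructure {
  carrier :> Type;
  mem : carrier -> carrier -> Prop
}.

Notation "x ∈ y" := (mem x y) (at level 70, no associativity).
Notation "x ∉ y" := (~ mem x y) (at level 70, no associativity).

(** First-order formulas in de Bruijn style: variable [0] refers to the
    innermost quantifier. *)
Inductive formula : Type :=
| FMem (i j : nat)
| FEq (i j : nat)
| FFalse
| FImp (p q : formula)
| FAnd (p q : formula)
| FOr (p q : formula)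
| FAll (p : formula)
| FEx (p : formula).

Definition scons (T : Type) (x : T) (e : nat -> T) (n : nat) : T :=
  match n with 0 => x | S n => e n end.

Fixpoint sat (M : set_structure) (e : nat -> M) (p : formula) : Prop :=
  match p with
  | FMem i j => e i ∈ e j
  | FEq i j => e i = e j
  | FFalse => False
  | FImp p q => sat e p -> sat e q
  | FAnd p q => sat e p /\ sat e q
  | FOr p q => sat e p \/ sat e q
  | FAll p => forall x : M, sat (scons x e) p
  | FEx p => exists x : M, sat (scons x e) p
  end.

Definition subset (M : set_structure) (x y : M) : Prop :=
  forall z : M, z ∈ x -> z ∈ y.

Definition is_empty (M : set_structure) (x : M) : Prop :=
  forall z : M, z ∉ x.

(** [s] is [x ∪ {x}]. *)
Definition is_succ (M : set_structure) (s x : M) : Prop :=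
  forall z : M, z ∈ s <-> z ∈ x \/ z = x.

Definition inductive_set (M : set_structure) (i : M) : Prop :=
  (exists e : M, is_empty e /\ e ∈ i) /\
  (forall x : M, x ∈ i -> exists s : M, is_succ s x /\ s ∈ i).

Record ZF (M : set_structure) : Prop := {
  zf_extensionality : forall x y : M,
    (forall z : M, z ∈ x <-> z ∈ y) -> x = y;
  zf_foundation : forall x : M,
    (exists y : M, y ∈ x) ->
    exists y : M, y ∈ x /\ forall z : M, z ∈ y -> z ∉ x;
  zf_pairing : forall x y : M,
    exists p : M, forall z : M, z ∈ p <-> z = x \/ z = y;
  zf_union : forall x : M,
    exists u : M, forall z : M, z ∈ u <-> exists y : M, y ∈ x /\ z ∈ y;
  zf_power : forall x : M,
    exists p : M, forall z : M, z ∈ p <-> subset z x;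
  zf_infinity : exists i : M, inductive_set i;
  zf_separation : forall (p : formula) (e : nat -> M) (x : M),
    exists y : M, forall z : M, z ∈ y <-> z ∈ x /\ sat (scons z e) p;
  zf_replacement : forall (p : formula) (e : nat -> M) (x : M),
    (forall u v v' : M, u ∈ x ->
       sat (scons u (scons v e)) p -> sat (scons u (scons v' e)) p -> v = v') ->
    exists y : M, forall v : M,
      v ∈ y <-> exists u : M, u ∈ x /\ sat (scons u (scons v e)) p
}.

(** [p] is [{x, y}]. *)
Definition is_upair (M : set_structure) (p x y : M) : Prop :=
  forall z : M, z ∈ p <-> z = x \/ z = y.

(** [p] is the Kuratowski pair [{{x}, {x, y}}]. *)
Definition is_pair (M : set_structure) (p x y : M) : Prop :=
  exists s d : M, is_upair s x x /\ is_upair d x y /\ is_upair p s d.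

Definition maps_to (M : set_structure) (f x y : M) : Prop :=
  exists p : M, is_pair p x y /\ p ∈ f.

Definition is_function (M : set_structure) (f a b : M) : Prop :=
  (forall p : M, p ∈ f -> exists x y : M, x ∈ a /\ y ∈ b /\ is_pair p x y) /\
  (forall x : M, x ∈ a -> exists! y : M, maps_to f x y).

Definition is_injection (M : set_structure) (f a b : M) : Prop :=
  is_function f a b /\
  (forall x x' y : M, maps_to f x y -> maps_to f x' y -> x = x').

Definition is_bijection (M : set_structure) (f a b : M) : Prop :=
  is_injection f a b /\
  (forall y : M, y ∈ b -> exists x : M, maps_to f x y).

Definition equinumerous (M : set_structure) (a b : M) : Prop :=
  exists f : M, is_bijection f a b.

Definition transitive_set (M : set_structure) (a : M) : Prop :=
  forall x : M, x ∈ a -> subset x a.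

Definition well_ordered_by_mem (M : set_structure) (a : M) : Prop :=
  (forall x : M, x ∈ a -> x ∉ x) /\
  (forall x y z : M, x ∈ a -> y ∈ a -> z ∈ a -> x ∈ y -> y ∈ z -> x ∈ z) /\
  (forall x y : M, x ∈ a -> y ∈ a -> x ∈ y \/ x = y \/ y ∈ x) /\
  (forall s : M, subset s a -> (exists x : M, x ∈ s) ->
     exists x : M, x ∈ s /\ forall y : M, y ∈ s -> x = y \/ x ∈ y).

Definition is_ordinal (M : set_structure) (a : M) : Prop :=
  transitive_set a /\ well_ordered_by_mem a.

Definition is_cardinal (M : set_structure) (k : M) : Prop :=
  is_ordinal k /\ forall a : M, a ∈ k -> ~ equinumerous a k.

(** [|x| = c]; in ZF a set that cannot be well-ordered has no such [c]. *)
Definition has_card (M : set_structure) (x c : M) : Prop :=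
  is_cardinal c /\ equinumerous x c.

Definition is_omega (M : set_structure) (w : M) : Prop :=
  inductive_set w /\ forall i : M, inductive_set i -> subset w i.

Definition countable (M : set_structure) (x : M) : Prop :=
  exists w f : M, is_omega w /\ is_injection f x w.

Definition uncountable (M : set_structure) (x : M) : Prop := ~ countable x.

(** [P] is [[k]^{<m}]. *)
Definition is_small_subsets (M : set_structure) (P k m : M) : Prop :=
  forall x : M, x ∈ P <-> subset x k /\ exists c : M, has_card x c /\ c ∈ m.

Definition set_mapping (M : set_structure) (F k m : M) : Prop :=
  exists P : M, is_small_subsets P k m /\ is_function F k P.

Definition free (M : set_structure) (F X : M) : Prop :=
  forall a b Fb : M, a ∈ X -> b ∈ X -> a <> b -> maps_to F b Fb -> a ∉ Fb.

Definition is_partition (M : set_structure) (P k : M) : Prop :=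
  (forall X : M, X ∈ P -> subset X k /\ exists x : M, x ∈ X) /\
  (forall X Y : M, X ∈ P -> Y ∈ P -> X <> Y -> forall x : M, x ∈ X -> x ∉ Y) /\
  (forall x : M, x ∈ k -> exists X : M, X ∈ P /\ x ∈ X).

Definition Free (M : set_structure) (k m l : M) : Prop :=
  forall F : M, set_mapping F k m ->
    exists A : M, subset A k /\ free F A /\ has_card A l.

Definition FreeUnion (M : set_structure) (k m l : M) : Prop :=
  forall F : M, set_mapping F k m ->
    exists P : M, is_partition P k /\ has_card P l /\
      forall X : M, X ∈ P -> free F X.

(* Main.v *)
(** Join [x] to [y] when [y] lies in [F x]; the resulting graph on [k] has finite
    out-degrees, and a countable proper colouring is found without any choice.
    Let [(g, n)] be the lexicographically least pair such that [x] is reached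
    from the vertex [g] by a path of length [n], and order the vertices by
    [(g, n, x)].  An out-neighbour of [x] never has a larger [g], and only
    finitely many vertices are reached from [g] in at most [n] steps, so each
    vertex has finitely many neighbours before it.  As the order is
    well-founded, only finitely many vertices can be reached from [x] by going
    down along edges; their number is the colour of [x], and it increases
    strictly along every edge.

    Joining in addition all pairs of finite ordinals keeps the out-degrees finite
    and forces infinitely many colours, so the colour classes form a partition
    into exactly [w] free sets.  If all classes were finite, then [k] would be
    countable, being ordered by (colour, ordinal) with finite initial segments;
    the first [w] elements of an infinite class form a free set of size [w]. *)

Require Import Defs.
From Stdlib Require Import Classical Arith.

Set Implicit Arguments.
Unset Strict Implicit.

Section Model.

Context {M : set_structure}.

(** ** Definable predicates *)

Inductive source : Type := Var (i : nat) | Cst (c : M).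

Definition value (e : nat -> M) (s : source) : M :=
  match s with Var i => e i | Cst c => c end.

(** Definability with parameters of a predicate on environments: [s] sends the
    free variables of [p] to variables of the environment or to parameters. *)
Definition dfn (P : (nat -> M) -> Prop) : Prop :=
  exists (p : formula) (s : nat -> source),
    forall e, P e <-> sat (fun n => value e (s n)) p.

Definition term (t : (nat -> M) -> M) : Prop :=
  exists s : source, forall e, t e = value e s.

Definition shift (e : nat -> M) (n : nat) : M := e (S n).

Fixpoint rename (f : nat -> nat) (p : formula) : formula :=
  let up := fun n => match n with 0 => 0 | S n => S (f n) end in
  match p with
  | FMem i j => FMem (f i) (f j)
  | FEq i j => FEq (f i) (f j)
  | FFalse => FFalse
  | FImp p q => FImp (rename f p) (rename f q)
  | FAnd p q => FAnd (rename f p) (rename f q)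
  | FOr p q => FOr (rename f p) (rename f q)
  | FAll p => FAll (rename up p)
  | FEx p => FEx (rename up p)
  end.

Lemma sat_rename (p : formula) : forall (f : nat -> nat) (e e' : nat -> M),
  (forall n, e' (f n) = e n) -> (sat e' (rename f p) <-> sat e p).
Proof.
  induction p; intros f e e' H; simpl; rewrite ?H;
    rewrite ?(IHp1 f e e' H), ?(IHp2 f e e' H); try tauto.
  - split; intros K x; specialize (K x); revert K; apply IHp; intros [|n]; simpl; auto.
  - split; intros [x K]; exists x; revert K; apply IHp; intros [|n]; simpl; auto.
Qed.

(** Two formulas come with unrelated assignments of variables and parameters. Spreading one over the
    even and the other over the odd positions gives both a common assignment, so that a connective
    can join them. *)
Definition interleave (s t : nat -> source) (n : nat) : source :=
  if Nat.even n then s (Nat.div2 n) else t (Nat.div2 n).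

Lemma interleave_even s t n : interleave s t (2 * n) = s n.
Proof.
  unfold interleave.
  now rewrite Nat.even_even, Nat.div2_double.
Qed.

Lemma interleave_odd s t n : interleave s t (S (2 * n)) = t n.
Proof.
  unfold interleave.
  now rewrite Nat.even_succ, <- Nat.negb_even, Nat.even_even, Nat.div2_succ_double.
Qed.

Lemma dfn_pair P Q : dfn P -> dfn Q -> exists p q s,
  (forall e, P e <-> sat (fun n => value e (s n)) p) /\
  (forall e, Q e <-> sat (fun n => value e (s n)) q).
Proof.
  intros [p [s Hp]] [q [t Hq]].
  exists (rename (fun n => 2 * n) p), (rename (fun n => S (2 * n)) q), (interleave s t).
  split; intros e; [rewrite (Hp e) | rewrite (Hq e)]; symmetry; apply sat_rename; intros n.
  - now rewrite interleave_even.
  - now rewrite interleave_odd.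
Qed.

Lemma dfn_and P Q : dfn P -> dfn Q -> dfn (fun e => P e /\ Q e).
Proof.
  intros HP HQ; destruct (dfn_pair HP HQ) as [p [q [s [H1 H2]]]].
  exists (FAnd p q), s; intros e; simpl; rewrite H1, H2; tauto.
Qed.

Lemma dfn_or P Q : dfn P -> dfn Q -> dfn (fun e => P e \/ Q e).
Proof.
  intros HP HQ; destruct (dfn_pair HP HQ) as [p [q [s [H1 H2]]]].
  exists (FOr p q), s; intros e; simpl; rewrite H1, H2; tauto.
Qed.

Lemma dfn_imp P Q : dfn P -> dfn Q -> dfn (fun e => P e -> Q e).
Proof.
  intros HP HQ; destruct (dfn_pair HP HQ) as [p [q [s [H1 H2]]]].
  exists (FImp p q), s; intros e; simpl; rewrite H1, H2; tauto.
Qed.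

Lemma dfn_False : dfn (fun _ => False).
Proof. exists FFalse, (fun n => Var n); intros e; simpl; tauto. Qed.

Lemma dfn_not P : dfn P -> dfn (fun e => ~ P e).
Proof. intros H; exact (dfn_imp H dfn_False). Qed.

Lemma dfn_iff P Q : dfn P -> dfn Q -> dfn (fun e => P e <-> Q e).
Proof. intros HP HQ; exact (dfn_and (dfn_imp HP HQ) (dfn_imp HQ HP)). Qed.

(** Several variables of the formula may stand for the quantified element. All of them are merged
    into variable 0, and every other variable moves up by one. The sources are lowered to match, and
    the source kept at a merged position is never read. *)
Lemma dfn_quantified (P : M -> (nat -> M) -> Prop) :
  dfn (fun e => P (e 0) (shift e)) ->
  exists p s, forall e x, P x e <-> sat (scons x (fun n => value e (s n))) p.
Proof.
  intros [p [s H]].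
  exists (rename (fun n => match s n with Var 0 => 0 | _ => S n end) p),
    (fun n => match s n with Var (S i) => Var i | Var 0 => Var 0 | Cst c => Cst c end).
  (* Since [shift (scons x e)] is [e] up to eta, this instance of [H] speaks of [P x e]. *)
  intros e x; rewrite (H (scons x e) : P x e <-> _).
  symmetry; apply sat_rename; intros n.
  destruct (s n) as [[|i]|c] eqn:E; simpl; rewrite ?E; reflexivity.
Qed.

Lemma dfn_all (P : M -> (nat -> M) -> Prop) :
  dfn (fun e => P (e 0) (shift e)) -> dfn (fun e => forall x, P x e).
Proof.
  intros H; destruct (dfn_quantified H) as [p [s K]].
  exists (FAll p), s; intros e; simpl.
  now split; intros L x; apply K.
Qed.

Lemma dfn_ex (P : M -> (nat -> M) -> Prop) :
  dfn (fun e => P (e 0) (shift e)) -> dfn (fun e => exists x, P x e).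
Proof.
  intros H; destruct (dfn_quantified H) as [p [s K]].
  exists (FEx p), s; intros e; simpl.
  now split; intros [x L]; exists x; apply K.
Qed.

Lemma term_var i : term (fun e => e i).
Proof. now exists (Var i). Qed.

Lemma term_cst c : term (fun _ => c).
Proof. now exists (Cst c). Qed.

Lemma dfn_mem t u : term t -> term u -> dfn (fun e => t e ∈ u e).
Proof.
  intros [a Ha] [b Hb].
  exists (FMem 0 1), (fun n => match n with 0 => a | _ => b end).
  intros e; simpl; rewrite Ha, Hb; tauto.
Qed.

Lemma dfn_eq t u : term t -> term u -> dfn (fun e => t e = u e).
Proof.
  intros [a Ha] [b Hb].
  exists (FEq 0 1), (fun n => match n with 0 => a | _ => b end).
  intros e; simpl; rewrite Ha, Hb; tauto.
Qed.

Lemma sat_ext p (e e' : nat -> M) : (forall n, e n = e' n) -> sat e p <-> sat e' p.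
Proof.
  intros H.
  rewrite <- (@sat_rename p (fun n => n) e e'), <- (@sat_rename p (fun n => n) e' e'); auto.
  tauto.
Qed.

Lemma dfn_subst P (t : nat -> (nat -> M) -> M) (s : nat -> source) :
  (forall n e, t n e = value e (s n)) -> dfn P -> dfn (fun e => P (fun n => t n e)).
Proof.
  intros H [p [s' K]].
  exists p, (fun n => match s' n with Var i => s i | Cst c => Cst c end); intros e.
  rewrite K; apply sat_ext; intros n.
  destruct (s' n); simpl; auto.
Qed.

Definition dfn1 (P : M -> Prop) : Prop := dfn (fun e => P (e 0)).
Definition dfn2 (P : M -> M -> Prop) : Prop := dfn (fun e => P (e 0) (e 1)).
Definition dfn3 (P : M -> M -> M -> Prop) : Prop := dfn (fun e => P (e 0) (e 1) (e 2)).

Lemma dfn1_app P t : dfn1 P -> term t -> dfn (fun e => P (t e)).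
Proof.
  intros HP [a Ha].
  now refine (@dfn_subst _ (fun _ => t) (fun _ => a) _ HP).
Qed.

Lemma dfn2_app P t u : dfn2 P -> term t -> term u -> dfn (fun e => P (t e) (u e)).
Proof.
  intros HP [a Ha] [b Hb].
  refine (@dfn_subst _ (fun n => match n with 0 => t | _ => u end)
    (fun n => match n with 0 => a | _ => b end) _ HP).
  intros [|n]; auto.
Qed.

Lemma dfn3_app P t u v : dfn3 P -> term t -> term u -> term v ->
  dfn (fun e => P (t e) (u e) (v e)).
Proof.
  intros HP [a Ha] [b Hb] [c Hc].
  refine (@dfn_subst _ (fun n => match n with 0 => t | 1 => u | _ => v end)
    (fun n => match n with 0 => a | 1 => b | _ => c end) _ HP).
  intros [|[|n]]; auto.
Qed.

End Model.

(* Automation for definability goals *)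
Create HintDb dfn.

Ltac solve_term := unfold shift; first [ apply term_cst | apply term_var ].

Ltac dfn_known := solve [auto 2 with dfn nocore].

(** Follows the syntax of the predicate down to its atoms. A named predicate is closed by a lemma
    from the hint base [dfn] instead of being unfolded again. *)
Ltac dfn_step :=
  lazymatch goal with
  | |- dfn (fun e => _ <-> _) => apply dfn_iff
  | |- dfn (fun e => _ /\ _) => apply dfn_and
  | |- dfn (fun e => _ \/ _) => apply dfn_or
  | |- dfn (fun e => ~ _) => apply dfn_not
  | |- dfn (fun e => False) => apply dfn_False
  | |- dfn (fun e => ex _) => apply dfn_ex
  | |- dfn (fun e => mem _ _) => apply dfn_mem; solve_term
  | |- dfn (fun e => _ = _) => apply dfn_eq; solve_term
  | |- dfn (fun e => forall x : carrier _, _) => apply dfn_all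
  | |- dfn (fun e => _ -> _) => apply dfn_imp
  | |- dfn1 _ => unfold dfn1
  | |- dfn2 _ => unfold dfn2
  | |- dfn3 _ => unfold dfn3
  | |- _ =>
    first [ eapply dfn1_app; [dfn_known | solve_term ..]
          | eapply dfn2_app; [dfn_known | solve_term ..]
          | eapply dfn3_app; [dfn_known | solve_term ..] ]
  end; cbv beta.

Ltac dfn := repeat dfn_step.
Tactic Notation "dfn" "unfolding" reference(r) := unfold r; dfn.

(** * Elementary set constructions and ordered pairs *)

Section SetTheory.

Context {M : set_structure} (HZF : ZF M).

Lemma dfn_is_empty : dfn1 (@is_empty M).
Proof. unfold is_empty; dfn. Qed.

Lemma dfn_subset : dfn2 (@subset M).
Proof. unfold subset; dfn. Qed.

Lemma dfn_is_succ : dfn2 (@is_succ M).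
Proof. unfold is_succ; dfn. Qed.

Lemma dfn_is_pair : dfn3 (@is_pair M).
Proof. unfold is_pair, is_upair; dfn. Qed.

#[local] Hint Resolve dfn_is_empty dfn_subset dfn_is_succ dfn_is_pair : dfn.

Lemma dfn_maps_to : dfn3 (@maps_to M).
Proof. unfold maps_to; dfn. Qed.

#[local] Hint Resolve dfn_maps_to : dfn.

Lemma dfn_is_function : dfn3 (@is_function M).
Proof. unfold is_function, unique; dfn. Qed.

#[local] Hint Resolve dfn_is_function : dfn.

Lemma dfn_equinumerous : dfn2 (@equinumerous M).
Proof. unfold equinumerous, is_bijection, is_injection; dfn. Qed.

#[local] Hint Resolve dfn_equinumerous : dfn.

Lemma separation (P : M -> Prop) (a : M) :
  dfn1 P -> exists y : M, forall z : M, z ∈ y <-> z ∈ a /\ P z.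
Proof.
  intros [p [s H]].
  (* [P] depends on one element only, so every variable is merged into variable 0, the element being
     tested. The parameter at position [n] is read at [S n], and [a] fills the positions that are
     never read. *)
  destruct (zf_separation HZF
    (rename (fun n => match s n with Var _ => 0 | Cst _ => S n end) p)
    (fun n => match s n with Var _ => a | Cst c => c end) a) as [y Hy].
  exists y; intros z; rewrite Hy.
  rewrite (H (fun _ => z)).
  rewrite (@sat_rename M p _ (fun n => value (fun _ => z) (s n))); [tauto|].
  intros n; destruct (s n) eqn:E; simpl; rewrite ?E; auto.
Qed.

Lemma ext (x y : M) : (forall z, z ∈ x <-> z ∈ y) -> x = y.
Proof. apply (zf_extensionality HZF). Qed.

Lemma empty_exists (x : M) : exists e : M, is_empty e.
Proof.
  destruct (@separation (fun _ => False) x) as [e He]; [dfn|].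
  exists e; intros z Hz; now apply He in Hz.
Qed.

Lemma empty_unique (x y : M) : is_empty x -> is_empty y -> x = y.
Proof.
  intros Hx Hy; apply ext; intros z.
  split; intros Hz; [now apply Hx in Hz | now apply Hy in Hz].
Qed.

Lemma union2 (a b : M) : exists u : M, forall z : M, z ∈ u <-> z ∈ a \/ z ∈ b.
Proof.
  destruct (zf_pairing HZF a b) as [p Hp], (zf_union HZF p) as [u Hu].
  exists u; intros z; rewrite Hu; split.
  - intros [y [Hy Hz]]; apply Hp in Hy as [-> | ->]; auto.
  - intros [H | H]; [exists a | exists b]; rewrite Hp; auto.
Qed.

Lemma insert_exists (a x : M) : exists u : M, forall z : M, z ∈ u <-> z ∈ a \/ z = x.
Proof.
  destruct (zf_pairing HZF x x) as [p Hp], (union2 a p) as [u Hu].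
  exists u; intros z; rewrite Hu, Hp; tauto.
Qed.

Lemma remove_exists (a x : M) : exists u : M, forall z : M, z ∈ u <-> z ∈ a /\ z <> x.
Proof. apply separation; dfn. Qed.

Lemma succ_exists (x : M) : exists s, is_succ s x.
Proof. apply insert_exists. Qed.

Lemma succ_unique (s t x : M) : is_succ s x -> is_succ t x -> s = t.
Proof. intros Hs Ht; apply ext; intros z; now rewrite (Hs z), (Ht z). Qed.

Lemma pair_exists (x y : M) : exists p, is_pair p x y.
Proof.
  destruct (zf_pairing HZF x x) as [s Hs], (zf_pairing HZF x y) as [d Hd].
  destruct (zf_pairing HZF s d) as [p Hp].
  exists p, s, d; repeat split; apply Hs || apply Hd || apply Hp.
Qed.

Lemma pair_injective (p x y x' y' : M) :
  is_pair p x y -> is_pair p x' y' -> x = x' /\ y = y'.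
Proof.
  intros [s [d [Hs [Hd Hp]]]] [s' [d' [Hs' [Hd' Hq]]]].
  assert (A : s = s' \/ s = d') by (apply Hq, Hp; auto).
  assert (B : d = s' \/ d = d') by (apply Hq, Hp; auto).
  assert (C : s' = s \/ s' = d) by (apply Hp, Hq; auto).
  assert (D : d' = s \/ d' = d) by (apply Hp, Hq; auto).
  assert (x = x') as <-.
  { destruct A as [<- | <-].
    - symmetry; destruct (proj1 (Hs x')); auto; apply Hs'; auto.
    - symmetry; destruct (proj1 (Hs x')); auto; apply Hd'; auto. }
  split; [reflexivity|].
  assert (s = s') as <- by (apply ext; intros z; now rewrite (Hs z), (Hs' z)).
  (* Either the doubletons agree, or both collapse to the singleton of [x], and then [y] and [y']
     equal [x]. *)
  assert (E : d = d' \/ (d = s /\ d' = s)) by (destruct B, D; auto).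
  destruct E as [<- | [-> ->]].
  - destruct (proj1 (Hd' y)) as [E | E]; [apply Hd; auto | | exact E].
    destruct (proj1 (Hd y')) as [F | F]; [apply Hd'; auto | congruence | auto].
  - transitivity x; [|symmetry].
    + destruct (proj1 (Hs y)); auto; apply Hd; auto.
    + destruct (proj1 (Hs y')); auto; apply Hd'; auto.
Qed.

(** Both [{x}] and [{x, y}] are subsets of [a ∪ b], so the pair lies in the double power set of the
    union. *)
Lemma product_bound (a b : M) : exists r : M, forall x y p : M,
  x ∈ a -> y ∈ b -> is_pair p x y -> p ∈ r.
Proof.
  destruct (union2 a b) as [q Hq], (zf_power HZF q) as [r' Hr'], (zf_power HZF r') as [r Hr].
  exists r; intros x y p Hx Hy [s [d [Hs [Hd Hp]]]].
  apply Hr; intros z Hz; apply Hr'; intros t Ht; apply Hq.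
  apply Hp in Hz as [-> | ->]; [apply Hs in Ht | apply Hd in Ht]; destruct Ht as [-> | ->]; auto.
Qed.

Lemma relation_set (R : M -> M -> Prop) (a b : M) : dfn2 R ->
  exists T : M, forall p : M, p ∈ T <-> exists x y, x ∈ a /\ y ∈ b /\ is_pair p x y /\ R x y.
Proof.
  intros HR.
  destruct (product_bound a b) as [r Hr].
  destruct (@separation (fun p => exists x y, x ∈ a /\ y ∈ b /\ is_pair p x y /\ R x y) r)
    as [T HT]; [dfn|].
  exists T; intros p; rewrite HT; split; [tauto|].
  intros H; split; [|exact H].
  destruct H as [x [y [Hx [Hy [Hp _]]]]].
  exact (Hr x y p Hx Hy Hp).
Qed.

(** ** Equinumerosity through definable relations *)

(** The last clause packs single-valuedness and injectivity into one equivalence. Only the values of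
    [R] between [a] and [b] matter. *)
Definition bijective_between (R : M -> M -> Prop) (a b : M) : Prop :=
  (forall x, x ∈ a -> exists y, y ∈ b /\ R x y) /\
  (forall y, y ∈ b -> exists x, x ∈ a /\ R x y) /\
  (forall x x' y y', x ∈ a -> x' ∈ a -> y ∈ b -> y' ∈ b -> R x y -> R x' y' ->
     (x = x' <-> y = y')).

Lemma graph_function (R : M -> M -> Prop) (a b f : M) :
  (forall p, p ∈ f <-> exists x y, x ∈ a /\ y ∈ b /\ is_pair p x y /\ R x y) ->
  forall x y, maps_to f x y <-> x ∈ a /\ y ∈ b /\ R x y.
Proof.
  intros Hf x y; split.
  - intros [p [Hp H]]; apply Hf in H as [x' [y' [Hx [Hy [Hp' HR]]]]].
    destruct (pair_injective Hp Hp') as [-> ->]; auto.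
  - intros [Hx [Hy HR]]; destruct (pair_exists x y) as [p Hp].
    exists p; split; [exact Hp|]; apply Hf; eauto 8.
Qed.

Lemma injection_intro (R : M -> M -> Prop) (a b : M) : dfn2 R ->
  (forall x, x ∈ a -> exists y, y ∈ b /\ R x y) ->
  (forall x x' y y', x ∈ a -> x' ∈ a -> y ∈ b -> y' ∈ b -> R x y -> R x' y' ->
     (x = x' <-> y = y')) ->
  exists f, is_injection f a b /\ forall x y, maps_to f x y <-> x ∈ a /\ y ∈ b /\ R x y.
Proof.
  intros HR Htot Huniq.
  destruct (relation_set a b HR) as [f Hf].
  pose proof (graph_function Hf) as G.
  exists f; split; [|exact G]; split; [split|].
  - intros p Hp; apply Hf in Hp as [x [y [Hx [Hy [Hp _]]]]]; eauto.
  - intros x Hx; destruct (Htot x Hx) as [y [Hy Hxy]].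
    exists y; split; [apply G; auto|].
    intros y' H; apply G in H as [_ [Hy' Hxy']].
    now apply (Huniq x x y y').
  - intros x x' y H H'; apply G in H as [Hx [Hy H]], H' as [Hx' [_ H']].
    now apply (Huniq x x' y y).
Qed.

(** Lets later bijections be given by definable relations: separation inside a bound for the product
    yields the graph, and conversely [maps_to f] is definable with parameter [f]. *)
Lemma equinumerous_iff (a b : M) :
  equinumerous a b <-> exists R, dfn2 R /\ bijective_between R a b.
Proof.
  split.
  - intros [f [[[Hdom Hfun] Hinj] Hsur]].
    assert (G : forall x y, maps_to f x y -> x ∈ a /\ y ∈ b).
    { intros x y [p [Hp H]]; destruct (Hdom p H) as [x' [y' [Hx [Hy Hp']]]].
      destruct (pair_injective Hp Hp') as [-> ->]; auto. }
    exists (maps_to f); split; [dfn|split; [|split]].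
    + intros x Hx; destruct (Hfun x Hx) as [y [Hy _]]; exists y; split; [apply (G x y)|]; auto.
    + intros y Hy; destruct (Hsur y Hy) as [x Hx]; exists x; split; [apply (G x y)|]; auto.
    + intros x x' y y' Hx Hx' Hy Hy' H H'; split; intros <-; [|eauto].
      destruct (Hfun x Hx) as [z [_ Hz]]; transitivity z; [symmetry|]; auto.
  - intros [R [HR [Htot [Hsur Huniq]]]].
    destruct (injection_intro HR Htot Huniq) as [f [Hf G]].
    exists f; split; [exact Hf|].
    intros y Hy; destruct (Hsur y Hy) as [x [Hx Hxy]]; exists x; apply G; auto.
Qed.

Lemma equinumerous_refl (a : M) : equinumerous a a.
Proof.
  apply equinumerous_iff; exists (fun x y => x = y); split; [dfn|].
  split; [|split]; eauto.
  intros x x' y y' _ _ _ _ -> ->; tauto.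
Qed.

Lemma equinumerous_sym (a b : M) : equinumerous a b -> equinumerous b a.
Proof.
  rewrite !equinumerous_iff; intros [R [HR [H1 [H2 H3]]]].
  exists (fun x y => R y x); split; [dfn|].
  split; [|split]; auto.
  intros; symmetry; auto.
Qed.

Lemma equinumerous_trans (a b c : M) :
  equinumerous a b -> equinumerous b c -> equinumerous a c.
Proof.
  rewrite !equinumerous_iff; intros [R [HR [R1 [R2 R3]]]] [S [HS [S1 [S2 S3]]]].
  exists (fun x z => exists y, y ∈ b /\ R x y /\ S y z); split; [dfn|].
  split; [|split].
  - intros x Hx; destruct (R1 x Hx) as [y [Hy ?]], (S1 y Hy) as [z [? ?]]; eauto 6.
  - intros z Hz; destruct (S2 z Hz) as [y [Hy ?]], (R2 y Hy) as [x [? ?]]; eauto 6.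
  - intros x x' z z' Hx Hx' Hz Hz' [y [Hy [H1 H2]]] [y' [Hy' [H1' H2']]].
    rewrite (R3 x x' y y'), (S3 y y' z z'); tauto.
Qed.

Lemma equinumerous_empty (a e : M) : is_empty e -> equinumerous a e <-> is_empty a.
Proof.
  intros He; split.
  - rewrite equinumerous_iff; intros [R [_ [H _]]] x Hx.
    destruct (H x Hx) as [y [Hy _]]; exact (He y Hy).
  - intros Ha; rewrite (empty_unique Ha He); apply equinumerous_refl.
Qed.

Lemma equinumerous_insert (a b u v a' b' : M) :
  equinumerous a b -> u ∉ a -> v ∉ b ->
  (forall z, z ∈ a' <-> z ∈ a \/ z = u) -> (forall z, z ∈ b' <-> z ∈ b \/ z = v) ->
  equinumerous a' b'.
Proof.
  rewrite !equinumerous_iff; intros [R [HR [R1 [R2 R3]]]] Hu Hv Ha Hb.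
  exists (fun x y => (x ∈ a /\ y ∈ b /\ R x y) \/ (x = u /\ y = v)); split; [dfn|].
  split; [|split].
  - intros x Hx; apply Ha in Hx as [Hx | ->].
    + destruct (R1 x Hx) as [y [? ?]]; exists y; rewrite Hb; auto.
    + exists v; rewrite Hb; auto.
  - intros y Hy; apply Hb in Hy as [Hy | ->].
    + destruct (R2 y Hy) as [x [? ?]]; exists x; rewrite Ha; auto.
    + exists u; rewrite Ha; auto.
  - intros x x' y y' _ _ _ _ [[Hx [Hy H]] | [-> ->]] [[Hx' [Hy' H']] | [-> ->]].
    + auto.
    + split; intros ->; contradiction.
    + split; intros <-; contradiction.
    + tauto.
Qed.

(* The preimage of [v] is redirected to the image of [u]. *)
Lemma equinumerous_remove (a b u v a' b' : M) :
  equinumerous a b -> u ∈ a -> v ∈ b ->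
  (forall z, z ∈ a' <-> z ∈ a /\ z <> u) -> (forall z, z ∈ b' <-> z ∈ b /\ z <> v) ->
  equinumerous a' b'.
Proof.
  rewrite !equinumerous_iff; intros [R [HR [R1 [R2 R3]]]] Hu Hv Ha Hb.
  exists (fun x y => R x y \/ (R x v /\ R u y)); split; [dfn|].
  split; [|split].
  - intros x Hx; apply Ha in Hx as [Hx Hxu].
    destruct (R1 x Hx) as [y [Hy Hxy]].
    destruct (classic (y = v)) as [-> | N].
    + destruct (R1 u Hu) as [z [Hz Huz]].
      exists z; rewrite Hb; repeat split; auto.
      intros ->; apply Hxu, (R3 x u v v); auto.
    + exists y; rewrite Hb; auto.
  - intros y Hy; apply Hb in Hy as [Hy Hyv].
    destruct (R2 y Hy) as [x [Hx Hxy]].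
    destruct (classic (x = u)) as [-> | N].
    + destruct (R2 v Hv) as [z [Hz Hzv]].
      exists z; rewrite Ha; repeat split; auto.
      intros ->; apply Hyv, (R3 u u y v); auto.
    + exists x; rewrite Ha; auto.
  - intros x x' y y' Hx Hx' Hy Hy'.
    apply Ha in Hx as [Hx Nx], Hx' as [Hx' Nx'].
    apply Hb in Hy as [Hy Ny], Hy' as [Hy' Ny'].
    intros [H | [H1 H2]] [H' | [H1' H2']].
    + auto.
    + pose proof (R3 x u y y' Hx Hu Hy Hy' H H2').
      pose proof (R3 x x' y v Hx Hx' Hy Hv H H1').
      tauto.
    + pose proof (R3 u x' y y' Hu Hx' Hy Hy' H2 H').
      pose proof (R3 x x' v y' Hx Hx' Hv Hy' H1 H').
      apply not_eq_sym in Nx', Ny'; tauto.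
    + pose proof (R3 x x' v v Hx Hx' Hv Hv H1 H1').
      pose proof (R3 u u y y' Hu Hu Hy Hy' H2 H2').
      tauto.
Qed.

(** ** Ordinals and natural numbers *)

Lemma ordinal_irrefl (a x : M) : is_ordinal a -> x ∈ a -> x ∉ x.
Proof. intros [_ [H _]]; apply H. Qed.

Lemma ordinal_trans (a x y z : M) :
  is_ordinal a -> z ∈ a -> x ∈ y -> y ∈ z -> x ∈ z.
Proof.
  intros [T [_ [H _]]] Hz Hxy Hyz.
  assert (y ∈ a) by (apply (T z); auto).
  apply (H x y z); auto; apply (T y); auto.
Qed.

Lemma ordinal_trichotomy (a x y : M) :
  is_ordinal a -> x ∈ a -> y ∈ a -> x ∈ y \/ x = y \/ y ∈ x.
Proof. intros [_ [_ [_ [H _]]]]; apply H. Qed.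

Lemma ordinal_min (a : M) (P : M -> Prop) :
  is_ordinal a -> dfn1 P -> (exists x, x ∈ a /\ P x) ->
  exists x, x ∈ a /\ P x /\ forall y, y ∈ a -> P y -> x = y \/ x ∈ y.
Proof.
  intros [_ [_ [_ [_ H]]]] HP [x Hx].
  destruct (@separation P a HP) as [s Hs].
  destruct (H s) as [m [Hm Hmin]].
  - intros z Hz; now apply Hs in Hz.
  - exists x; now apply Hs.
  - exists m; apply Hs in Hm as [? ?]; repeat split; auto.
    intros y Hy HPy; apply Hmin, Hs; auto.
Qed.

Context (w : M) (Hw : is_omega w).

(** The elements of [w] with property [P] form a set by separation, whence the definability
    hypothesis, and this set is inductive. The model may have nonstandard numbers, so induction over
    [nat] could not replace this. *)
Lemma omega_ind (P : M -> Prop) : dfn1 P ->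
  (forall e, is_empty e -> P e) ->
  (forall n s, n ∈ w -> P n -> is_succ s n -> P s) ->
  forall n, n ∈ w -> P n.
Proof.
  intros HP H0 HS.
  destruct (@separation P w HP) as [y Hy].
  enough (inductive_set y) as I by (intros n Hn; apply (proj2 Hw y I), Hy in Hn; tauto).
  destruct (proj1 Hw) as [[e [He Hew]] Hs].
  split.
  - exists e; rewrite Hy; auto.
  - intros x Hx; apply Hy in Hx as [Hx HPx]; destruct (Hs x Hx) as [s [? ?]].
    exists s; rewrite Hy; eauto.
Qed.

Ltac omega_induction :=
  match goal with |- forall n, n ∈ _ -> @?P n => apply (@omega_ind P); cbv beta end.

Lemma omega_zero (e : M) : is_empty e -> e ∈ w.
Proof.
  destruct (proj1 Hw) as [[e' [He' H]] _]; intros He; now rewrite (empty_unique He He').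
Qed.

Lemma omega_succ (n s : M) : n ∈ w -> is_succ s n -> s ∈ w.
Proof.
  intros Hn Hs; destruct (proj1 Hw) as [_ H]; destruct (H n Hn) as [t [Ht Htw]].
  now rewrite (succ_unique Hs Ht).
Qed.

Lemma omega_case (n : M) : n ∈ w -> is_empty n \/ exists m, m ∈ w /\ is_succ n m.
Proof. revert n; omega_induction; [dfn | auto | eauto]. Qed.

Lemma omega_transitive : transitive_set w.
Proof.
  change (forall n, n ∈ w -> subset n w); omega_induction; [dfn| |].
  - intros e He z Hz; now apply He in Hz.
  - intros n s Hn H Hs z Hz; apply Hs in Hz as [Hz | ->]; auto.
Qed.

Lemma natural_transitive (n : M) : n ∈ w -> transitive_set n.
Proof.
  revert n; omega_induction; [dfn unfolding transitive_set| |].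
  - intros e He z Hz; now apply He in Hz.
  - intros n s Hn H Hs z Hz t Ht; apply Hs; apply Hs in Hz as [Hz | ->]; auto.
    left; apply (H z); auto.
Qed.

Lemma natural_irrefl (n : M) : n ∈ w -> n ∉ n.
Proof.
  revert n; omega_induction; [dfn| |].
  - intros e He; apply He.
  - intros n s Hn H Hs Hss; apply H.
    assert (n ∈ s) by (apply Hs; auto).
    apply Hs in Hss as [K | K]; [|congruence].
    apply (natural_transitive Hn K); auto.
Qed.

Lemma natural_trichotomy (n m : M) : n ∈ w -> m ∈ w -> n ∈ m \/ n = m \/ m ∈ n.
Proof.
  intros Hn; revert n Hn m.
  (* [Z] compares zero with every number; [S] shows that the successor of a member of [n] does not
     pass [n]. They supply the base case and the successor case of the main induction. *)
  assert (Z : forall m, m ∈ w -> forall e, is_empty e -> e ∈ m \/ e = m).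
  { omega_induction; [dfn| |].
    - intros e He e' He'; right; apply empty_unique; auto.
    - intros n s Hn H Hs e He; left; apply Hs; destruct (H e He); auto. }
  assert (S : forall n, n ∈ w -> forall m s, m ∈ n -> is_succ s m -> s ∈ n \/ s = n).
  { omega_induction; [dfn| |].
    - intros e He m s Hm; now apply He in Hm.
    - intros n s Hn H Hs m t Hm Ht; apply Hs in Hm as [Hm | ->].
      + left; apply Hs; eauto.
      + right; apply (succ_unique Ht Hs). }
  apply (@omega_ind (fun n => forall m, m ∈ w -> n ∈ m \/ n = m \/ m ∈ n)); [dfn| |].
  - intros e He m Hm; destruct (Z m Hm e He); auto.
  - intros n s Hn H Hs m Hm; destruct (H m Hm) as [K | [<- | K]].
    + destruct (S m Hm n s K Hs); auto.
    + right; right; apply Hs; auto.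
    + right; right; apply Hs; auto.
Qed.

Lemma omega_ordinal : is_ordinal w.
Proof.
  split; [exact omega_transitive|]; split; [exact natural_irrefl|].
  split; [|split].
  - intros x y z _ _ Hz Hxy Hyz; apply (natural_transitive Hz Hyz); auto.
  - intros x y; apply natural_trichotomy.
  - intros s Hs [x Hx]; apply NNPP; intros N.
    (* If [s] has no least element, induction on [n] shows that no member of [n] lies in [s]. The
       successor of [x] then gives the contradiction. *)
    assert (K : forall n, n ∈ w -> forall y, y ∈ n -> y ∉ s).
    { omega_induction; [dfn| |].
      - intros e He y Hy; now apply He in Hy.
      - intros n t Hn H Ht y Hy Hys; apply Ht in Hy as [Hy | ->]; [exact (H y Hy Hys)|].
        apply N; exists n; split; auto; intros z Hz.
        destruct (natural_trichotomy Hn (Hs z Hz)) as [L | [L | L]]; auto.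
        destruct (H z L Hz). }
    destruct (succ_exists x) as [t Ht].
    apply (K t) with x; auto; [|apply Ht; auto].
    apply (omega_succ (Hs x Hx) Ht).
Qed.

Lemma succ_injective (n m s : M) : n ∈ w -> is_succ s n -> is_succ s m -> n = m.
Proof.
  intros Hn H K.
  assert (A : n ∈ m \/ n = m) by (apply K, H; auto).
  assert (B : m ∈ n \/ m = n) by (apply H, K; auto).
  destruct A as [A | A], B as [B | B]; auto.
  destruct (natural_irrefl Hn); apply (natural_transitive Hn B); auto.
Qed.

(** ** Finite sets *)

Definition finite (x : M) : Prop := exists n, n ∈ w /\ equinumerous x n.

Lemma dfn_finite : dfn1 finite.
Proof. unfold finite; dfn. Qed.

#[local] Hint Resolve dfn_finite : dfn.

Lemma finite_empty (e : M) : is_empty e -> finite e.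
Proof. intros He; exists e; split; [apply omega_zero, He | apply equinumerous_refl]. Qed.

Lemma equinumerous_succ (x n u x' s : M) : n ∈ w ->
  equinumerous x n -> u ∉ x -> (forall z, z ∈ x' <-> z ∈ x \/ z = u) -> is_succ s n ->
  equinumerous x' s.
Proof.
  intros Hn H Hu Hx' Hs.
  apply (equinumerous_insert H Hu (natural_irrefl Hn) Hx' Hs).
Qed.

Lemma equinumerous_pred (x n u x' s : M) : n ∈ w ->
  equinumerous x s -> u ∈ x -> (forall z, z ∈ x' <-> z ∈ x /\ z <> u) -> is_succ s n ->
  equinumerous x' n.
Proof.
  intros Hn H Hu Hx' Hs.
  apply (@equinumerous_remove x s u n x' n); auto; [apply Hs; auto|].
  intros z; rewrite (Hs z); split; [|tauto].
  intros Hz; split; [auto|]; intros ->; exact (natural_irrefl Hn Hz).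
Qed.

Lemma finite_insert (x u x' : M) :
  finite x -> (forall z, z ∈ x' <-> z ∈ x \/ z = u) -> finite x'.
Proof.
  intros [n [Hn H]] Hx'.
  destruct (classic (u ∈ x)) as [Hu | Hu].
  - exists n; split; auto.
    enough (x' = x) as -> by auto.
    apply ext; intros z; rewrite Hx'; split; [intros [Hz | ->] | ]; auto.
  - destruct (succ_exists n) as [s Hs].
    exists s; split; [exact (omega_succ Hn Hs) | exact (equinumerous_succ Hn H Hu Hx' Hs)].
Qed.

(** Induction on the number of elements: the element matched with the top number [n] is taken out,
    leaving a set of size [n]. *)
Lemma finite_ind (P : M -> Prop) : dfn1 P ->
  (forall e, is_empty e -> P e) ->
  (forall x u x', finite x -> P x -> u ∉ x ->
     (forall z, z ∈ x' <-> z ∈ x \/ z = u) -> P x') ->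
  forall x, finite x -> P x.
Proof.
  intros HP H0 HS x [n [Hn H]].
  revert n Hn x H; apply (@omega_ind (fun n => forall x, equinumerous x n -> P x)); [dfn| |].
  - intros e He x Hx; apply H0, (equinumerous_empty x He), Hx.
  - intros n s Hn IH Hs x Hx.
    destruct (proj1 (equinumerous_iff x s) Hx) as [R [_ [_ [HR _]]]].
    destruct (HR n) as [u [Hu _]]; [apply Hs; auto|].
    destruct (remove_exists x u) as [y Hy].
    pose proof (equinumerous_pred Hn Hx Hu Hy Hs) as Hyn.
    apply (HS y u x); [exists n; auto | auto | |].
    + intros K; apply Hy in K; tauto.
    + intros z; rewrite Hy; destruct (classic (z = u)) as [-> | ]; tauto.
Qed.

Lemma natural_equinumerous_eq (n m : M) : n ∈ w -> m ∈ w -> equinumerous n m -> n = m.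
Proof.
  intros Hn; revert n Hn m.
  apply (@omega_ind (fun n => forall m, m ∈ w -> equinumerous n m -> n = m)); [dfn| |].
  - intros e He m _ H; apply empty_unique; auto.
    apply (equinumerous_empty m He), equinumerous_sym, H.
  - intros n s Hn IH Hs m Hm H.
    destruct (omega_case Hm) as [E | [m' [Hm' Hmm]]].
    + apply (equinumerous_empty s E) in H; destruct (H n); apply Hs; auto.
    + rewrite <- (IH m' Hm') in Hmm; [exact (succ_unique Hs Hmm)|].
      apply (@equinumerous_pred s m' n n m); auto.
      * apply Hs; auto.
      * intros z; rewrite (Hs z); split; [|tauto].
        intros Hz; split; auto; intros ->; exact (natural_irrefl Hn Hz).
Qed.

(** Induction on [n]: discarding from [x] a point outside [y] lowers the size by one and keeps [y]
    inside. This is the source of all strict inequalities between sizes below. *)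
Lemma card_subset (n x y : M) : n ∈ w -> equinumerous x n -> subset y x ->
  y = x \/ exists m, m ∈ n /\ equinumerous y m.
Proof.
  intros Hn; revert n Hn x y.
  apply (@omega_ind (fun n => forall x y, equinumerous x n -> subset y x ->
    y = x \/ exists m, m ∈ n /\ equinumerous y m)); [dfn| |].
  - intros e He x y Hx Hyx; left; apply (equinumerous_empty x He) in Hx.
    apply empty_unique; auto; intros z Hz; apply (Hx z), Hyx, Hz.
  - intros n s Hn IH Hs x y Hx Hyx.
    destruct (classic (y = x)) as [E | E]; [auto|right].
    destruct (classic (exists u, u ∈ x /\ u ∉ y)) as [[u [Hu Huy]] | K].
    + destruct (remove_exists x u) as [x' Hx'].
      pose proof (equinumerous_pred Hn Hx Hu Hx' Hs) as Hn'.
      destruct (IH x' y Hn') as [-> | [m [Hm Hym]]].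
      * intros z Hz; apply Hx'; split; [auto|]; intros ->; auto.
      * exists n; split; auto; apply Hs; auto.
      * exists m; split; auto; apply Hs; auto.
    + destruct E; apply ext; intros z; split; [apply Hyx|].
      intros Hz; apply NNPP; intros N; apply K; eauto.
Qed.

Lemma finite_subset (x y : M) : finite x -> subset y x -> finite y.
Proof.
  intros [n [Hn H]] Hy; destruct (card_subset Hn H Hy) as [-> | [m [Hm K]]].
  - exists n; auto.
  - exists m; split; auto; exact (omega_transitive Hn Hm).
Qed.

(** If [w] had size [n], the subset [s = n + 1] of [w] would either be all of [w], giving a number
    that is a member of itself, or have a size in [n], although its size is [s]. *)
Lemma omega_infinite : ~ finite w.
Proof.
  intros [n [Hn H]].
  destruct (succ_exists n) as [s Hs].
  pose proof (omega_succ Hn Hs) as Hsw.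
  destruct (card_subset Hn H (omega_transitive Hsw)) as [-> | [m [Hm K]]].
  - exact (natural_irrefl Hsw Hsw).
  - assert (Hmw : m ∈ w) by exact (omega_transitive Hn Hm).
    rewrite <- (natural_equinumerous_eq Hsw Hmw K) in Hm.
    apply (natural_irrefl Hn), (natural_transitive Hn Hm), Hs; auto.
Qed.

Lemma finite_union (a b u : M) :
  finite a -> finite b -> (forall z, z ∈ u <-> z ∈ a \/ z ∈ b) -> finite u.
Proof.
  intros Ha Hb; revert a Ha u.
  apply (@finite_ind (fun a => forall u, (forall z, z ∈ u <-> z ∈ a \/ z ∈ b) -> finite u));
    [dfn| |].
  - intros e He u Hu; apply (finite_subset Hb).
    intros z Hz; apply Hu in Hz as [Hz | Hz]; auto; now apply He in Hz.
  - intros x v x' _ IH _ Hx' u Hu.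
    destruct (union2 x b) as [t Ht].
    apply (@finite_insert t v u (IH t Ht)).
    intros z; rewrite Hu, Hx', Ht; tauto.
Qed.

Lemma natural_finite (n : M) : n ∈ w -> finite n.
Proof. exists n; split; auto; apply equinumerous_refl. Qed.

Lemma omega_cardinal : is_cardinal w.
Proof.
  split; [exact omega_ordinal|].
  intros a Ha H; apply omega_infinite; exists a; split; auto; now apply equinumerous_sym.
Qed.

(** Bounding by a finite set avoids naming the set that [P] cuts out, and makes sense without
    definability of [P]. *)
Definition finite_class (P : M -> Prop) : Prop :=
  exists u, finite u /\ forall z, P z -> z ∈ u.

Lemma finite_class_sub (P Q : M -> Prop) :
  finite_class Q -> (forall z, P z -> Q z) -> finite_class P.
Proof. intros [u [Hu H]] K; exists u; auto. Qed.

Lemma finite_class_or (P Q : M -> Prop) :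
  finite_class P -> finite_class Q -> finite_class (fun z => P z \/ Q z).
Proof.
  intros [u [Hu H]] [v [Hv K]]; destruct (union2 u v) as [t Ht].
  exists t; split; [exact (finite_union Hu Hv Ht)|].
  intros z [Hz | Hz]; apply Ht; auto.
Qed.

Lemma finite_class_set (x : M) (P : M -> Prop) :
  (forall z, z ∈ x <-> P z) -> finite_class P <-> finite x.
Proof.
  intros H; split.
  - intros [u [Hu K]]; apply (finite_subset Hu); intros z Hz; apply K, H, Hz.
  - intros Hx; exists x; split; auto; intros z; apply H.
Qed.

Lemma finite_class_singleton (x : M) : finite_class (fun z => z = x).
Proof.
  destruct (empty_exists w) as [e He], (insert_exists e x) as [s Hs].
  exists s; split; [apply (finite_insert (finite_empty He) Hs)|].
  intros z ->; apply Hs; auto.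
Qed.

(** Induction on [x] obtains the bounding sets one at a time, so that no choice is made in the
    model. *)
Lemma finite_class_union (R : M -> M -> Prop) (x : M) : dfn2 R -> finite x ->
  (forall y, y ∈ x -> finite_class (R y)) ->
  finite_class (fun z => exists y, y ∈ x /\ R y z).
Proof.
  intros HR; revert x.
  apply (@finite_ind (fun x => (forall y, y ∈ x -> finite_class (R y)) ->
    finite_class (fun z => exists y, y ∈ x /\ R y z))); [dfn unfolding finite_class| |].
  - intros e He _; exists e; split; [apply finite_empty, He|].
    intros z [y [Hy _]]; now apply He in Hy.
  - intros x u x' _ IH _ Hx' K.
    apply finite_class_sub with (fun z => (exists y, y ∈ x /\ R y z) \/ R u z).
    + apply finite_class_or; [apply IH; intros y Hy|]; apply K, Hx'; auto.
    + intros z [y [Hy Hz]]; apply Hx' in Hy as [Hy | ->]; eauto.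
Qed.

(** The size of a finite section, as a relation. It serves twice: as the rank of an element in an
    order with finite initial segments, and as the colour of a vertex. *)
Definition section_card (a : M) (Q : M -> M -> Prop) (x n : M) : Prop :=
  n ∈ w /\ exists s, (forall z, z ∈ s <-> z ∈ a /\ Q x z) /\ equinumerous s n.

Lemma dfn_section_card (a : M) (Q : M -> M -> Prop) : dfn2 Q -> dfn2 (section_card a Q).
Proof. intros HQ; unfold section_card; dfn. Qed.

#[local] Hint Resolve dfn_section_card : dfn.

Lemma section_card_exists (a x : M) (Q : M -> M -> Prop) : dfn2 Q ->
  finite_class (fun z => z ∈ a /\ Q x z) -> exists n, n ∈ w /\ section_card a Q x n.
Proof.
  intros HQ H.
  destruct (@separation (Q x) a) as [s Hs]; [dfn|].
  destruct (proj1 (finite_class_set Hs) H) as [n [Hn K]].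
  exists n; unfold section_card; eauto.
Qed.

Lemma section_card_unique (a x n m : M) (Q : M -> M -> Prop) :
  section_card a Q x n -> section_card a Q x m -> n = m.
Proof.
  intros [Hn [s [Hs H]]] [Hm [t [Ht K]]]; apply natural_equinumerous_eq; auto.
  assert (s = t) as <- by (apply ext; intros z; now rewrite Hs, Ht).
  apply (equinumerous_trans (equinumerous_sym H) K).
Qed.

Lemma section_card_mono (a x y n m : M) (Q : M -> M -> Prop) :
  (forall z, z ∈ a -> Q x z -> Q y z) -> (exists z, z ∈ a /\ Q y z /\ ~ Q x z) ->
  section_card a Q x n -> section_card a Q y m -> n ∈ m.
Proof.
  intros Hsub [z [Hz [Hy Hx]]] [Hn [s [Hs H]]] [Hm [t [Ht K]]].
  destruct (card_subset Hm K (y := s)) as [-> | [m' [Hm' L]]].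
  - intros v Hv; apply Ht; apply Hs in Hv as [? ?]; auto.
  - destruct Hx, (proj1 (Hs z)); auto; apply Ht; auto.
  - enough (n = m') as -> by auto.
    apply natural_equinumerous_eq; auto; [exact (omega_transitive Hm Hm')|].
    apply (equinumerous_trans (equinumerous_sym H) L).
Qed.

(** ** Linear orders with finite initial segments *)

Definition strict_linear (a : M) (lt : M -> M -> Prop) : Prop :=
  (forall x, x ∈ a -> ~ lt x x) /\
  (forall x y z, x ∈ a -> y ∈ a -> z ∈ a -> lt x y -> lt y z -> lt x z) /\
  (forall x y, x ∈ a -> y ∈ a -> lt x y \/ x = y \/ lt y x).

Definition segments_finite (a : M) (lt : M -> M -> Prop) : Prop :=
  forall x, x ∈ a -> finite_class (fun y => y ∈ a /\ lt y x).

Section OmegaType.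

Context (a : M) (lt : M -> M -> Prop) (Hlt : dfn2 lt).
Context (Hlin : strict_linear a lt) (Hfin : segments_finite a lt).

Local Notation rank := (section_card a (fun x y => lt y x)).

Lemma dfn_rank : dfn2 rank.
Proof. apply dfn_section_card; dfn. Qed.

#[local] Hint Resolve dfn_rank : dfn.

Lemma rank_exists (x : M) : x ∈ a -> exists n, n ∈ w /\ rank x n.
Proof. intros Hx; apply section_card_exists; [dfn | exact (Hfin Hx)]. Qed.

Lemma rank_mono (x y n m : M) : x ∈ a -> y ∈ a -> lt x y -> rank x n -> rank y m -> n ∈ m.
Proof.
  intros Hx Hy Hxy; destruct Hlin as [Hirr [Htr _]].
  apply section_card_mono; [intros z Hz; eauto | exists x; auto].
Qed.

Lemma rank_injective (x x' y y' : M) : x ∈ a -> x' ∈ a -> y ∈ w -> y' ∈ w ->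
  rank x y -> rank x' y' -> (x = x' <-> y = y').
Proof.
  intros Hx Hx' Hy Hy' H H'; split.
  - intros <-; exact (section_card_unique H H').
  - intros <-; destruct (proj2 (proj2 Hlin) x x' Hx Hx') as [K | [K | K]]; auto;
      destruct (natural_irrefl Hy).
    + apply (rank_mono Hx Hx' K H H').
    + apply (rank_mono Hx' Hx K H' H).
Qed.

Lemma countable_of_segments : countable a.
Proof.
  destruct (@injection_intro rank a w) as [f [Hf _]]; [dfn|exact rank_exists|exact rank_injective|].
  exists w, f; auto.
Qed.

(** The rank is injective; suppose [n] is the least number that is not a rank. The set [b] of
    elements of rank below [n] has size [n], so, [a] being infinite, something lies outside [b]. An
    element of least rank outside [b] has exactly [b] before it, hence has rank [n] after all. *)
Lemma equinumerous_omega_of_segments : ~ finite a -> equinumerous a w.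
Proof.
  intros Hinf; apply equinumerous_iff; exists rank; split; [dfn|].
  split; [exact rank_exists|split; [|exact rank_injective]].
  intros n0 Hn0; apply NNPP; intros N0.
  destruct (@ordinal_min w (fun n => ~ exists x, x ∈ a /\ rank x n) omega_ordinal)
    as [n [Hn [N Hmin]]]; [dfn | eauto|].
  destruct (@separation (fun x => exists m, m ∈ n /\ rank x m) a) as [b Hb]; [dfn|].
  assert (Hbn : equinumerous b n).
  { apply equinumerous_iff; exists rank; split; [dfn|split; [|split]].
    - intros x Hx; apply Hb in Hx as [_ H]; exact H.
    - intros m Hm.
      assert (Hmw : m ∈ w) by exact (omega_transitive Hn Hm).
      apply NNPP; intros K; destruct (Hmin m Hmw) as [-> | L].
      + intros [x [Hx Hxm]]; apply K; exists x; split; auto; apply Hb; eauto.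
      + exact (natural_irrefl Hn Hm).
      + destruct (natural_irrefl Hn); apply (natural_transitive Hn Hm); auto.
    - intros x x' y y' Hx Hx' Hy Hy'; apply Hb in Hx as [Hx _], Hx' as [Hx' _].
      apply rank_injective; auto; apply (omega_transitive Hn); auto. }
  destruct (classic (exists x, x ∈ a /\ x ∉ b)) as [[x0 [Hx0 Hx0b]] | K].
  - destruct (rank_exists Hx0) as [m0 [Hm0 Hr0]].
    destruct (@ordinal_min w (fun m => exists x, x ∈ a /\ x ∉ b /\ rank x m) omega_ordinal)
      as [m [Hm [[x [Hx [Hxb Hxm]]] Hmin']]]; [dfn | eauto 6|].
    apply N; exists x; split; auto; split; auto.
    exists b; split; auto.
    intros z; split.
    + intros Hz; apply Hb in Hz as [Hz [l [Hl Hzl]]]; split; auto.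
      destruct (proj2 (proj2 Hlin) z x Hz Hx) as [L | [-> | L]]; auto.
      * destruct Hxb; apply Hb; eauto.
      * destruct Hxb; apply Hb; split; auto; exists m; split; auto.
        apply (natural_transitive Hn Hl), (rank_mono Hx Hz L Hxm Hzl).
    + intros [Hz Hzx]; apply NNPP; intros Hzb.
      destruct (rank_exists Hz) as [l [Hl Hzl]].
      pose proof (rank_mono Hz Hx Hzx Hzl Hxm) as L.
      destruct (Hmin' l Hl) as [-> | L']; [eauto | |].
      * exact (natural_irrefl Hl L).
      * exact (natural_irrefl Hm (natural_transitive Hm L L')).
  - apply Hinf; exists n; split; auto.
    enough (a = b) as -> by auto.
    apply ext; intros z; rewrite Hb; split; [|tauto].
    intros Hz; apply Hb; apply NNPP; eauto.
Qed.

End OmegaType.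

Lemma ordinal_linear (k a : M) :
  is_ordinal k -> subset a k -> strict_linear a (fun x y => x ∈ y).
Proof.
  intros Hk Ha; split; [|split].
  - intros x Hx; apply (ordinal_irrefl Hk); auto.
  - intros x y z _ _ Hz; apply (ordinal_trans Hk); auto.
  - intros x y Hx Hy; apply (ordinal_trichotomy Hk); auto.
Qed.

(** [b] consists of the first [w] elements of [a]. Were it finite, the least element of [a] outside
    [b] would have only members of [b] before it in [a], and so would belong to [b]. *)
Lemma infinite_ordinals_omega (k a b : M) : is_ordinal k -> subset a k -> ~ finite a ->
  (forall x, x ∈ b <-> x ∈ a /\ finite_class (fun y => y ∈ a /\ y ∈ x)) ->
  ~ finite b /\ equinumerous b w.
Proof.
  intros Hk Ha Hinf Hb.
  assert (Hb' : ~ finite b).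
  { intros Hbf.
    destruct (@ordinal_min k (fun x => x ∈ a /\ x ∉ b) Hk)
      as [x [Hx [[Hxa Hxb] Hmin]]]; [dfn| |].
    - apply NNPP; intros N; apply Hinf, (finite_subset Hbf).
      intros z Hz; apply NNPP; intros K; apply N; exists z; auto.
    - apply Hxb, Hb; split; auto.
      exists b; split; auto; intros z [Hz Hzx]; apply NNPP; intros Hzb.
      destruct (Hmin z (Ha z Hz)) as [-> | L]; auto.
      + exact (ordinal_irrefl Hk (Ha z Hz) Hzx).
      + exact (ordinal_irrefl Hk Hx (ordinal_trans Hk Hx L Hzx)). }
  split; auto.
  apply (@equinumerous_omega_of_segments b (fun x y => x ∈ y)); [dfn| | |auto].
  - apply (ordinal_linear Hk); intros z Hz; apply Ha, Hb, Hz.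
  - intros x Hx; apply Hb in Hx as [_ H]; apply (finite_class_sub H).
    intros z [Hz ?]; apply Hb in Hz; tauto.
Qed.

(** ** Colouring along a well-founded relation *)

Section Coloring.

Context (k : M) (lt pred : M -> M -> Prop) (Hlt : dfn2 lt) (Hpred : dfn2 pred).
Context (Hlin : strict_linear k lt).
(** Well-foundedness of [lt], stated for definable classes. *)
Context (Hmin : forall P, dfn1 P -> (exists x, x ∈ k /\ P x) ->
  exists x, x ∈ k /\ P x /\ forall y, y ∈ k -> lt y x -> ~ P y).
Context (Hpred_lt : forall x y, pred x y -> y ∈ k /\ lt y x).
Context (Hpred_finite : forall x, x ∈ k -> finite_class (pred x)).

(* Membership of [y] in the least set containing the predecessors of [x] and
   closed under predecessors; the colour of [x] will be the size of that set. *)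
Definition below (x y : M) : Prop :=
  forall s : M, (forall z, pred x z -> z ∈ s) ->
    (forall u z, u ∈ s -> pred u z -> z ∈ s) -> y ∈ s.

Lemma dfn_below : dfn2 below.
Proof. unfold below; dfn. Qed.

#[local] Hint Resolve dfn_below : dfn.

Lemma below_pred (x y : M) : pred x y -> below x y.
Proof. intros H s Hs _; auto. Qed.

Lemma below_trans (x y z : M) : pred x y -> below y z -> below x z.
Proof. intros H K s Hs Hcl; apply K; eauto. Qed.

Lemma below_step (x y z : M) : below x y -> pred y z -> below x z.
Proof. intros H K s Hs Hcl; apply (Hcl y z); auto; apply H; auto. Qed.

(** The elements of [k] before [x] form a set that contains the predecessors of [x] and is closed
    under predecessors, so it is one of the sets tested in [below]. *)
Lemma below_lt (x y : M) : x ∈ k -> below x y -> y ∈ k /\ lt y x.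
Proof.
  intros Hx H; destruct (@separation (fun z => lt z x) k) as [s Hs]; [dfn|].
  apply Hs, H.
  - intros z Hz; apply Hs; auto.
  - intros u z Hu Hz; apply Hs in Hu as [Hu Hux]; apply Hs.
    destruct (Hpred_lt Hz) as [Hzk Hzu]; split; auto.
    apply (proj1 (proj2 Hlin) z u x); auto.
Qed.

(** At a minimal counterexample [y], whatever is below [y] is one of its finitely many predecessors
    or lies below one, and for each predecessor the claim already holds. *)
Lemma below_finite (x : M) : x ∈ k -> finite_class (below x).
Proof.
  intros Hx0; apply NNPP; intros N0.
  destruct (Hmin (P := fun x => ~ finite_class (below x))) as [y [Hy [N IH]]];
    [dfn unfolding finite_class | eauto|].
  apply N; destruct (Hpred_finite Hy) as [u [Hu Hyu]].
  (* The bound [u] may contain elements that are not predecessors of [y]; keeping [pred y v] in the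
     relation makes their contribution empty. *)
  apply finite_class_sub
    with (fun z => exists v, v ∈ u /\ (pred y v /\ (z = v \/ below v z))).
  - apply (@finite_class_union (fun v z => pred y v /\ (z = v \/ below v z))); [dfn|auto|].
    intros v _; destruct (classic (pred y v)) as [Hv | Hv].
    + apply finite_class_sub with (fun z => z = v \/ below v z); [|tauto].
      apply finite_class_or; [apply finite_class_singleton|].
      destruct (Hpred_lt Hv); apply NNPP; auto.
    + apply finite_class_sub with (fun z => z = v); [apply finite_class_singleton|tauto].
  - intros z Hz.
    (* [below] can only be tested on sets, so the class is cut out of [k] and shown to be closed
       under predecessors. *)
    destruct (@separation (fun z => exists v, v ∈ u /\ (pred y v /\ (z = v \/ below v z))) k)
      as [s Hs]; [dfn|].
    apply Hs, Hz.
    + intros v Hv; apply Hs; split; [apply (Hpred_lt Hv)|]; exists v; auto.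
    + intros v t Hv Ht; apply Hs; apply Hs in Hv as [_ [r [Hr [Hyr Hv]]]].
      split; [apply (Hpred_lt Ht)|]; exists r; split; [auto|split; [auto|right]].
      destruct Hv as [-> | Hv]; [apply below_pred | apply below_step with v]; auto.
Qed.

(** If [y] is a predecessor of [x], all that is below [y] is below [x], while [y] itself is below
    [x] but not below [y]. The inclusion is therefore proper and the sizes differ strictly. *)
Lemma coloring_by_pred : exists C : M -> M -> Prop, dfn2 C /\
  (forall x, x ∈ k -> exists n, n ∈ w /\ C x n) /\
  (forall x n m, C x n -> C x m -> n = m) /\
  (forall x y n m, x ∈ k -> pred x y -> C x n -> C y m -> m ∈ n).
Proof.
  exists (section_card k below); split; [dfn|]; split; [|split].
  - intros x Hx; apply (@section_card_exists k x below); [dfn|].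
    apply finite_class_sub with (below x); [exact (below_finite Hx) | tauto].
  - intros x n m; apply section_card_unique.
  - intros x y n m Hx Hxy Hn Hm; destruct (Hpred_lt Hxy) as [Hy _].
    refine (section_card_mono _ _ Hm Hn).
    + intros z _; apply below_trans, Hxy.
    + exists y; split; [auto|]; split; [apply below_pred, Hxy|].
      intros K; destruct (below_lt Hy K) as [_ L]; exact (proj1 Hlin y Hy L).
Qed.

End Coloring.

(** ** Well-ordering the vertices with finitely many earlier neighbours *)

Section Ordering.

Context (k : M) (Hk : is_ordinal k) (E : M -> M -> Prop) (HE : dfn2 E).
Context (Hfin : forall x, x ∈ k -> finite_class (fun y => y ∈ k /\ E x y)).

(* There is an [E]-path of length [n] from [g] to [x]: the pair [(n, x)] lies in
   every set [t] containing [(0, g)] and closed under edges. *)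
Definition reach (g n x : M) : Prop :=
  n ∈ w /\ x ∈ k /\ forall t : M,
    (forall e, is_empty e -> maps_to t e g) ->
    (forall m y z s, maps_to t m y -> z ∈ k -> E y z -> is_succ s m -> maps_to t s z) ->
    maps_to t n x.

Lemma dfn_reach : dfn3 reach.
Proof. unfold reach; dfn. Qed.

#[local] Hint Resolve dfn_reach : dfn.

Lemma reach_zero (g e : M) : g ∈ k -> is_empty e -> reach g e g.
Proof. intros Hg He; split; [apply omega_zero, He|]; auto. Qed.

Lemma reach_succ (g n s y z : M) :
  reach g n y -> z ∈ k -> E y z -> is_succ s n -> reach g s z.
Proof.
  intros [Hn [Hy H]] Hz HEyz Hs; split; [exact (omega_succ Hn Hs)|split; [auto|]].
  intros t H0 H1; apply (H1 n y z s); auto.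
Qed.

(** The reached pairs for which the conclusion holds form a set that contains [(0, g)] and is closed
    under edges, so [reach] puts [(n, x)] into it. *)
Lemma reach_inv (g n x : M) : g ∈ k -> reach g n x ->
  (is_empty n /\ x = g) \/ exists m y, is_succ n m /\ reach g m y /\ E y x.
Proof.
  intros Hg Hx.
  destruct (@relation_set (fun n x => reach g n x /\
    ((is_empty n /\ x = g) \/ exists m y, is_succ n m /\ reach g m y /\ E y x)) w k)
    as [t Ht]; [dfn|].
  pose proof (graph_function Ht) as G.
  apply (G n x), Hx.
  - intros e He; apply G; split; [apply omega_zero, He|].
    split; [auto|]; split; [apply reach_zero|]; auto.
  - intros m y z s Hmy Hz Hyz Hs; apply G in Hmy as [Hm [Hy [Hr _]]].
    apply G; split; [exact (omega_succ Hm Hs)|]; split; [auto|]; split.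
    + exact (reach_succ Hr Hz Hyz Hs).
    + right; eauto.
Qed.

Lemma reach_finite (g n : M) : g ∈ k -> n ∈ w -> finite_class (reach g n).
Proof.
  intros Hg; revert n; change (forall n, n ∈ w -> (fun n => finite_class (reach g n)) n).
  omega_induction; [dfn unfolding finite_class| |].
  - intros e He; apply finite_class_sub with (fun z => z = g); [apply finite_class_singleton|].
    intros z Hz; apply reach_inv in Hz as [[_ H] | [m [y [H _]]]]; auto.
    destruct (He m); apply H; auto.
  - intros n s Hn [u [Hu Hnu]] Hs.
    apply finite_class_sub with (fun z => exists y, y ∈ u /\ (y ∈ k /\ z ∈ k /\ E y z)).
    + apply (@finite_class_union (fun y z => y ∈ k /\ z ∈ k /\ E y z)); [dfn|auto|].
      intros y _; destruct (classic (y ∈ k)) as [Hy | Hy].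
      * apply (finite_class_sub (Hfin Hy)); tauto.
      (* For [y] outside [k] the relation is empty, and any finite class bounds it. *)
      * apply finite_class_sub with (fun z => z = y); [apply finite_class_singleton|tauto].
    + intros z Hz; pose proof (proj1 (proj2 Hz)) as Hzk.
      apply reach_inv in Hz as [[H _] | [m [y [Hm [Hr HEyz]]]]]; auto.
      * destruct (H n); apply Hs; auto.
      * rewrite <- (succ_injective Hn Hs Hm) in Hr.
        exists y; repeat split; auto; apply Hr.
Qed.

Definition code (x g n : M) : Prop :=
  g ∈ k /\ reach g n x /\ forall g' n', g' ∈ k -> reach g' n' x ->
    g ∈ g' \/ (g = g' /\ (n = n' \/ n ∈ n')).

Lemma dfn_code : dfn3 code.
Proof. unfold code; dfn. Qed.

#[local] Hint Resolve dfn_code : dfn.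

(** First [g] is minimized over [k], then [n] over [w] for that [g]. The path of length zero from
    [x] to itself provides a candidate. *)
Lemma code_exists (x : M) : x ∈ k -> exists g n, code x g n.
Proof.
  intros Hx; destruct (empty_exists x) as [e He].
  destruct (@ordinal_min k (fun g => exists n, reach g n x) Hk) as [g [Hg [[n0 Hn0] Hmin]]];
    [dfn | exists x; split; [auto|]; exists e; apply reach_zero; auto|].
  destruct (@ordinal_min w (fun n => reach g n x) omega_ordinal) as [n [Hn [Hr Hmin']]];
    [dfn | exists n0; split; [apply Hn0 | auto]|].
  exists g, n; split; [auto|]; split; [auto|].
  intros g' n' Hg' Hr'; destruct (Hmin g' Hg') as [<- | H]; [eauto| |auto].
  right; split; auto; apply Hmin'; auto; apply Hr'.
Qed.

Lemma code_unique (x g n g' n' : M) : code x g n -> code x g' n' -> g = g' /\ n = n'.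
Proof.
  intros [Hg [Hr H]] [Hg' [Hr' H']].
  assert (Hn : n ∈ w) by apply Hr.
  destruct (H g' n' Hg' Hr') as [K | [<- K]].
  - destruct (H' g n Hg Hr) as [L | [<- L]].
    + destruct (ordinal_irrefl Hk Hg); apply (ordinal_trans Hk Hg K L).
    + destruct (ordinal_irrefl Hk Hg' K).
  - split; auto; destruct K as [K | K]; auto.
    destruct (H' g n Hg Hr) as [L | [_ [L | L]]]; auto.
    + destruct (ordinal_irrefl Hk Hg L).
    + destruct (natural_irrefl Hn); apply (natural_transitive Hn L K).
Qed.

(** A path from [g] to [x] extends along the edge to [y], so [g] competes for the least origin of
    [y]. *)
Lemma code_edge (x y g n h m : M) : x ∈ k -> y ∈ k -> E x y ->
  code x g n -> code y h m -> h ∈ g \/ h = g.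
Proof.
  intros Hx Hy Hxy [Hg [Hr _]] [_ [_ H]].
  destruct (succ_exists n) as [s Hs].
  destruct (H g s Hg (reach_succ Hr Hy Hxy Hs)) as [K | [K _]]; auto.
Qed.

Definition before (y x : M) : Prop :=
  exists h m g n, code y h m /\ code x g n /\
    (h ∈ g \/ (h = g /\ (m ∈ n \/ (m = n /\ y ∈ x)))).

Lemma dfn_before : dfn2 before.
Proof. unfold before; dfn. Qed.

#[local] Hint Resolve dfn_before : dfn.

Lemma before_iff (y x h m g n : M) : code y h m -> code x g n ->
  (before y x <-> h ∈ g \/ (h = g /\ (m ∈ n \/ (m = n /\ y ∈ x)))).
Proof.
  intros Hy Hx; split.
  - intros [h' [m' [g' [n' [Hy' [Hx' H]]]]]].
    destruct (code_unique Hy Hy') as [-> ->], (code_unique Hx Hx') as [-> ->]; exact H.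
  - intros H; exists h, m, g, n; auto.
Qed.

Lemma before_linear : strict_linear k before.
Proof.
  split; [|split].
  - intros x Hx; destruct (code_exists Hx) as [g [n H]]; rewrite (before_iff H H).
    destruct H as [Hg [[Hn _] _]].
    intros [K | [_ [K | [_ K]]]]; revert K;
      [apply (ordinal_irrefl Hk Hg) | apply (natural_irrefl Hn) | apply (ordinal_irrefl Hk Hx)].
  - intros x y z Hx Hy Hz.
    destruct (code_exists Hx) as [g [n Hxc]], (code_exists Hy) as [h [m Hyc]],
      (code_exists Hz) as [i [l Hzc]].
    rewrite (before_iff Hxc Hyc), (before_iff Hyc Hzc), (before_iff Hxc Hzc).
    destruct Hzc as [Hi [[Hl _] _]].
    intros [A | [-> [A | [-> A]]]] [B | [-> [B | [-> B]]]]; auto.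
    + left; apply (ordinal_trans Hk Hi A B).
    + right; split; auto; left; apply (natural_transitive Hl B A).
    + right; split; auto; right; split; auto; apply (ordinal_trans Hk Hz A B).
  - intros x y Hx Hy.
    destruct (code_exists Hx) as [g [n Hxc]], (code_exists Hy) as [h [m Hyc]].
    rewrite (before_iff Hxc Hyc), (before_iff Hyc Hxc).
    destruct Hxc as [Hg [[Hn _] _]], Hyc as [Hh [[Hm _] _]].
    destruct (ordinal_trichotomy Hk Hg Hh) as [A | [<- | A]]; auto.
    destruct (natural_trichotomy Hn Hm) as [B | [<- | B]]; auto 6.
    destruct (ordinal_trichotomy Hk Hx Hy) as [C | [<- | C]]; auto 8.
Qed.

(** Three minimizations in turn: over the origin, then over the path length for that origin, then
    over the vertex for that code. *)
Lemma before_min (P : M -> Prop) : dfn1 P -> (exists x, x ∈ k /\ P x) ->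
  exists x, x ∈ k /\ P x /\ forall y, y ∈ k -> before y x -> ~ P y.
Proof.
  intros HP [x0 [Hx0 HPx0]].
  destruct (code_exists Hx0) as [g0 [n0 H0]].
  destruct (@ordinal_min k (fun g => exists x n, x ∈ k /\ P x /\ code x g n) Hk)
    as [g [Hg [[x1 [n1 [Hx1 [HP1 H1]]]] Ming]]];
    [dfn | exists g0; split; [apply H0 | eauto 6]|].
  destruct (@ordinal_min w (fun n => exists x, x ∈ k /\ P x /\ code x g n) omega_ordinal)
    as [n [Hn [[x2 [Hx2 [HP2 H2]]] Minn]]];
    [dfn | exists n1; split; [apply H1 | eauto 6]|].
  destruct (@ordinal_min k (fun x => P x /\ code x g n) Hk)
    as [x [Hx [[HPx Hxc] Minx]]]; [dfn | eauto|].
  exists x; split; [auto|]; split; [auto|].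
  intros y Hy Hyx HPy; destruct (code_exists Hy) as [h [m Hyc]].
  assert (Hh : h ∈ k) by apply Hyc.
  assert (Hm : m ∈ w) by apply Hyc.
  apply (before_iff Hyc Hxc) in Hyx as [A | [-> [A | [-> A]]]].
  - destruct (Ming h Hh) as [-> | B]; [eauto 6 | |].
    + exact (ordinal_irrefl Hk Hh A).
    + exact (ordinal_irrefl Hk Hh (ordinal_trans Hk Hh A B)).
  - destruct (Minn m Hm) as [-> | B]; [eauto 6 | |].
    + exact (natural_irrefl Hm A).
    + exact (natural_irrefl Hm (natural_transitive Hm B A)).
  - destruct (Minx y Hy) as [-> | B]; [auto | |].
    + exact (ordinal_irrefl Hk Hy A).
    + exact (ordinal_irrefl Hk Hy (ordinal_trans Hk Hy A B)).
Qed.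

Definition earlier_neighbour (x y : M) : Prop :=
  x ∈ k /\ y ∈ k /\ before y x /\ (E x y \/ E y x).

Lemma dfn_earlier_neighbour : dfn2 earlier_neighbour.
Proof. unfold earlier_neighbour; dfn. Qed.

(** Out-neighbours are finitely many by hypothesis. If [y] comes before [x] and has an edge to [x],
    its origin is at most [g] by the order and at least [g] by [code_edge]. So [y] is reached from
    [g] by a path whose length is at most [n], that is, a member of the successor [s]. *)
Lemma earlier_neighbour_finite (x : M) : x ∈ k -> finite_class (earlier_neighbour x).
Proof.
  intros Hx; destruct (code_exists Hx) as [g [n Hxc]].
  pose proof Hxc as [Hg [[Hn _] _]].
  destruct (succ_exists n) as [s Hs].
  apply finite_class_sub
    with (fun y => (y ∈ k /\ E x y) \/ exists m, m ∈ s /\ reach g m y).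
  - apply finite_class_or; [auto|].
    pose proof (omega_succ Hn Hs) as Hsw.
    apply finite_class_union; [dfn | apply natural_finite, Hsw |].
    intros m Hm; apply reach_finite; auto; apply (omega_transitive Hsw Hm).
  - intros y [_ [Hy [Hyx [A | A]]]]; auto; right.
    destruct (code_exists Hy) as [h [m Hyc]].
    assert (Hgh : h = g /\ (m ∈ n \/ m = n)).
    { apply (before_iff Hyc Hxc) in Hyx as [B | [<- B]]; [|tauto].
      assert (Hh : h ∈ k) by apply Hyc.
      destruct (code_edge Hy Hx A Hyc Hxc) as [C | C].
      - destruct (ordinal_irrefl Hk Hh); apply (ordinal_trans Hk Hh B C).
      - rewrite C in B; destruct (ordinal_irrefl Hk Hh B). }
    destruct Hgh as [-> Hm]; exists m; split; [apply Hs, Hm | apply Hyc].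
Qed.

(** Of two distinct adjacent vertices one is an earlier neighbour of the other, so a common colour
    [n] would satisfy [n ∈ n]. *)
Lemma proper_coloring : exists C : M -> M -> Prop, dfn2 C /\
  (forall x, x ∈ k -> exists n, n ∈ w /\ C x n) /\
  (forall x n m, C x n -> C x m -> n = m) /\
  (forall x y n, x ∈ k -> y ∈ k -> x <> y -> E x y -> C x n -> ~ C y n).
Proof.
  destruct (@coloring_by_pred k before earlier_neighbour) as [C [HC [Htot [Huniq Hcol]]]].
  - apply dfn_before.
  - apply dfn_earlier_neighbour.
  - exact before_linear.
  - exact before_min.
  - intros x y [_ [Hy [H _]]]; auto.
  - exact earlier_neighbour_finite.
  - exists C; split; [auto|]; split; [auto|]; split; [auto|].
    intros x y n Hx Hy Hne Hxy Hxn Hyn.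
    assert (Hnn : n ∈ n).
    { destruct (proj2 (proj2 before_linear) x y Hx Hy) as [H | [H | H]]; [|contradiction|].
      - apply (Hcol y x n n); auto; split; auto.
      - apply (Hcol x y n n); auto; split; auto. }
    destruct (Htot x Hx) as [n' [Hn' H]].
    rewrite (Huniq x n n' Hxn H) in Hnn; exact (natural_irrefl Hn' Hnn).
Qed.

End Ordering.

Lemma finite_class_subsingleton (P : M -> Prop) :
  (forall x y, P x -> P y -> x = y) -> finite_class P.
Proof.
  intros H; destruct (classic (exists x, P x)) as [[x Hx] | N].
  - apply finite_class_sub with (fun z => z = x); [apply finite_class_singleton | auto].
  (* [P] is empty here, and [w] is an arbitrary element used for the bound. *)
  - apply finite_class_sub with (fun z => z = w); [apply finite_class_singleton|].
    intros z Hz; destruct N; eauto.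
Qed.

Lemma finite_countable (x : M) : finite x -> countable x.
Proof.
  intros [n [Hn H]]; apply equinumerous_iff in H as [R [HR [R1 [_ R3]]]].
  pose proof (omega_transitive Hn) as Hnw.
  destruct (@injection_intro (fun x y => y ∈ n /\ R x y) x w) as [f [Hf _]]; [dfn| | |].
  - intros y Hy; destruct (R1 y Hy) as [m [Hm ?]]; exists m; auto.
  - intros y y' m m' Hy Hy' _ _ [Hm H] [Hm' H']; auto.
  - exists w, f; auto.
Qed.

(** * Colour classes of a colouring of an ordinal by natural numbers *)

Section Classes.

Context (k : M) (Hk : is_ordinal k) (C : M -> M -> Prop) (HC : dfn2 C).
Context (Htot : forall x, x ∈ k -> exists n, n ∈ w /\ C x n).
Context (Huniq : forall x n m, C x n -> C x m -> n = m).

(** Compare colours first, and use membership within a colour. What comes before [y] lies in the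
    finitely many fibres up to the colour of [y]. The order of [k] arranges all fibres uniformly, so
    no enumerations have to be chosen. *)
Lemma countable_of_finite_fibres :
  (forall n, n ∈ w -> finite_class (fun x => x ∈ k /\ C x n)) -> countable k.
Proof.
  intros Hfin.
  pose (lt := fun x y => exists n m, C x n /\ C y m /\ (n ∈ m \/ (n = m /\ x ∈ y))).
  assert (Hiff : forall x y n m, C x n -> C y m -> (lt x y <-> n ∈ m \/ (n = m /\ x ∈ y))).
  { intros x y n m Hx Hy; split; [|exists n, m; auto].
    intros [n' [m' [Hx' [Hy' H]]]]; now rewrite (Huniq Hx Hx'), (Huniq Hy Hy'). }
  apply (@countable_of_segments k lt); [unfold lt; dfn| |].
  - split; [|split].
    + intros x Hx; destruct (Htot Hx) as [n [Hn H]]; rewrite (Hiff _ _ _ _ H H).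
      intros [K | [_ K]]; [exact (natural_irrefl Hn K) | exact (ordinal_irrefl Hk Hx K)].
    + intros x y z Hx Hy Hz.
      destruct (Htot Hx) as [n [Hn Hxn]], (Htot Hy) as [m [Hm Hym]], (Htot Hz) as [l [Hl Hzl]].
      rewrite (Hiff _ _ _ _ Hxn Hym), (Hiff _ _ _ _ Hym Hzl), (Hiff _ _ _ _ Hxn Hzl).
      intros [A | [-> A]] [B | [-> B]]; auto.
      * left; exact (natural_transitive Hl B A).
      * right; split; auto; exact (ordinal_trans Hk Hz A B).
    + intros x y Hx Hy.
      destruct (Htot Hx) as [n [Hn Hxn]], (Htot Hy) as [m [Hm Hym]].
      rewrite (Hiff _ _ _ _ Hxn Hym), (Hiff _ _ _ _ Hym Hxn).
      destruct (natural_trichotomy Hn Hm) as [A | [<- | A]]; auto.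
      destruct (ordinal_trichotomy Hk Hx Hy) as [B | [<- | B]]; auto.
  - intros y Hy; destruct (Htot Hy) as [m [Hm Hym]].
    destruct (succ_exists m) as [s Hs].
    pose proof (omega_succ Hm Hs) as Hsw.
    apply finite_class_sub with (fun x => exists n, n ∈ s /\ (x ∈ k /\ C x n)).
    + apply (@finite_class_union (fun n x => x ∈ k /\ C x n));
        [dfn | apply natural_finite, Hsw |].
      intros n Hn; apply Hfin, (omega_transitive Hsw Hn).
    + intros x [Hx [n [m' [Hxn [Hym' H]]]]].
      rewrite <- (Huniq Hym Hym') in H.
      exists n; split; [apply Hs; tauto | auto].
Qed.

(** Nonemptiness makes the colour of a class unique, and is also required of the parts of a
    partition. *)
Definition colour_class (X n : M) : Prop :=
  n ∈ w /\ (exists x, x ∈ X) /\ forall z, z ∈ X <-> z ∈ k /\ C z n.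

Lemma dfn_colour_class : dfn2 colour_class.
Proof. unfold colour_class; dfn. Qed.

#[local] Hint Resolve dfn_colour_class : dfn.

Lemma colour_class_unique (X n m : M) : colour_class X n -> colour_class X m -> n = m.
Proof.
  intros [_ [[x Hx] H]] [_ [_ K]].
  apply (@Huniq x); [apply H, Hx | apply K, Hx].
Qed.

Lemma colour_class_ext (X Y n : M) : colour_class X n -> colour_class Y n -> X = Y.
Proof. intros [_ [_ H]] [_ [_ K]]; apply ext; intros z; now rewrite H, K. Qed.

(** Ordered by colour, the classes have finite initial segments. Infinitely many of them thus have
    order type [w], even if some colours are not taken. *)
Lemma colour_partition : exists P : M, is_partition P k /\
  (forall X, X ∈ P <-> exists n, colour_class X n) /\ (~ finite P -> equinumerous P w).
Proof.
  destruct (zf_power HZF k) as [Q HQ].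
  destruct (@separation (fun X => exists n, colour_class X n) Q) as [P HP']; [dfn|].
  assert (HP : forall X, X ∈ P <-> exists n, colour_class X n).
  { intros X; rewrite HP'; split; [tauto|]; intros [n H]; split; [|eauto].
    apply HQ; intros z Hz; apply H, Hz. }
  exists P; split; [|split; [exact HP|]].
  - split; [|split].
    + intros X HX; apply HP in HX as [n [_ [H1 H2]]]; split; auto.
      intros z Hz; apply H2, Hz.
    + intros X Y HX HY HXY x Hx Hy; apply HXY.
      apply HP in HX as [n HX], HY as [m HY].
      assert (n = m) as <- by (apply (@Huniq x); [apply HX, Hx | apply HY, Hy]).
      exact (colour_class_ext HX HY).
    + intros x Hx; destruct (Htot Hx) as [n [Hn H]].
      destruct (@separation (fun z => C z n) k) as [X HX]; [dfn|].
      exists X; split; [|apply HX; auto].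
      apply HP; exists n; split; [auto|]; split; [|exact HX].
      exists x; apply HX; auto.
  - apply equinumerous_omega_of_segments
      with (lt := fun X Y => exists n m, colour_class X n /\ colour_class Y m /\ n ∈ m);
      [dfn| |].
    + split; [|split].
      * intros X _ [n [m [Hn [Hm H]]]]; rewrite (colour_class_unique Hn Hm) in H.
        exact (natural_irrefl (proj1 Hm) H).
      * intros X Y Z _ _ _ [n [m [Hn [Hm H]]]] [m' [l [Hm' [Hl K]]]].
        rewrite (colour_class_unique Hm' Hm) in K.
        exists n, l; split; [auto|]; split; [auto|].
        exact (natural_transitive (proj1 Hl) K H).
      * intros X Y HX HY; apply HP in HX as [n HX], HY as [m HY].
        destruct (natural_trichotomy (proj1 HX) (proj1 HY)) as [K | [<- | K]].
        -- left; exists n, m; auto.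
        -- right; left; exact (colour_class_ext HX HY).
        -- right; right; exists m, n; auto.
    + intros Y HY; apply HP in HY as [m HY].
      apply finite_class_sub with (fun X => exists n, n ∈ m /\ colour_class X n).
      * apply (@finite_class_union (fun n X => colour_class X n));
          [dfn | apply natural_finite, HY |].
        intros n _; apply finite_class_subsingleton; intros X X'; apply colour_class_ext.
      * intros X [_ [n [m' [Hn [Hm' H]]]]].
        exists n; now rewrite (colour_class_unique HY Hm').
Qed.

End Classes.

(** * Free sets and free partitions for set mappings with finite values *)

Section FreeSets.

Context (k : M) (Hk : is_ordinal k) (Hunc : uncountable k).
Context (F : M) (HF : set_mapping F k w).

(* The finite ordinals are made pairwise adjacent, which forces infinitely many colours. *)
Definition edge (x y : M) : Prop :=
  (exists s, maps_to F x s /\ y ∈ s) \/ (finite x /\ y ∈ x).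

Lemma dfn_edge : dfn2 edge.
Proof. unfold edge; dfn. Qed.

Lemma edge_finite (x : M) : x ∈ k -> finite_class (fun y => y ∈ k /\ edge x y).
Proof.
  intros Hx; destruct HF as [P [HP [Hdom Hfun]]].
  apply finite_class_sub
    with (fun y => (exists s, maps_to F x s /\ y ∈ s) \/ (finite x /\ y ∈ x));
    [|unfold edge; tauto].
  apply finite_class_or.
  - destruct (Hfun x Hx) as [s [[p [Hp HpF]] Hs]].
    assert (Hsf : finite s).
    { destruct (Hdom p HpF) as [x' [s' [_ [HsP Hp']]]].
      destruct (pair_injective Hp Hp') as [_ <-].
      apply HP in HsP as [_ [c [[_ Hc] Hcw]]]; exists c; auto. }
    exists s; split; auto; intros y [s' [Hs' Hy]]; now rewrite (Hs s' Hs').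
  - destruct (classic (finite x)) as [H | H].
    + exists x; tauto.
    + apply finite_class_subsingleton; tauto.
Qed.

(** A member of [F b] other than [b] is adjacent to [b], so sets of one colour are free. The last
    clause reflects the edges added between finite ordinals and will rule out a finite number of
    classes. *)
Lemma free_coloring : exists C : M -> M -> Prop, dfn2 C /\
  (forall x, x ∈ k -> exists n, n ∈ w /\ C x n) /\
  (forall x n m, C x n -> C x m -> n = m) /\
  (forall X n, subset X k -> (forall x, x ∈ X -> C x n) -> free F X) /\
  (forall x y n, x ∈ k -> y ∈ k -> finite x -> finite y -> C x n -> C y n -> x = y).
Proof.
  destruct (proper_coloring Hk dfn_edge edge_finite) as [C [HC [Htot [Huniq Hprop]]]].
  exists C; split; [auto|]; split; [auto|]; split; [auto|]; split.
  - intros X n HX Hn a b Fb Ha Hb Hab HFb Hmem.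
    apply (Hprop b a n); auto; left; eauto.
  - intros x y n Hx Hy Hfx Hfy Hxn Hyn; apply NNPP; intros Hne.
    destruct (ordinal_trichotomy Hk Hx Hy) as [H | [H | H]]; [|contradiction|].
    + apply (Hprop y x n); auto; right; auto.
    + apply (Hprop x y n); auto; right; auto.
Qed.

Lemma ordinal_infinite : ~ finite k.
Proof. intros H; exact (Hunc (finite_countable H)). Qed.

(** The elements of [k] before [x] are exactly the members of [x], so the finite ordinals are the
    first [w] elements of the infinite set [k]. *)
Lemma finite_ordinals_infinite (A : M) : (forall x, x ∈ A <-> x ∈ k /\ finite x) -> ~ finite A.
Proof.
  intros HA; apply (@infinite_ordinals_omega k k A); auto; [intros z; auto|apply ordinal_infinite|].
  intros x; rewrite HA.
  split; intros [Hx H]; split; auto; revert H; apply finite_class_set;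
    intros z; (split; [|tauto]); intros Hz; split; auto; apply (proj1 Hk x Hx z Hz).
Qed.

Lemma free_omega : exists A : M, subset A k /\ free F A /\ has_card A w.
Proof.
  destruct free_coloring as [C [HC [Htot [Huniq [Hfree _]]]]].
  destruct (classic (exists n, n ∈ w /\ ~ finite_class (fun x => x ∈ k /\ C x n)))
    as [[n [Hn Hinf]] | N].
  - destruct (@separation (fun x => C x n) k) as [A HA]; [dfn|].
    (* [B] is the initial part of order type [w] of the infinite colour class [A]. *)
    destruct (@separation (fun x => finite_class (fun y => y ∈ A /\ y ∈ x)) A) as [B HB];
      [dfn unfolding finite_class|].
    assert (HAk : subset A k) by (intros z Hz; apply HA, Hz).
    assert (HBA : subset B A) by (intros z Hz; apply HB, Hz).
    assert (HBk : subset B k) by (intros z Hz; apply HAk, HBA, Hz).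
    exists B; split; [auto|]; split.
    + apply Hfree with n; auto; intros x Hx; apply HA, HBA, Hx.
    + split; [exact omega_cardinal|].
      apply (infinite_ordinals_omega Hk HAk); auto.
      intros H; apply Hinf, (finite_class_set HA), H.
  - destruct Hunc; apply (@countable_of_finite_fibres k Hk C); auto.
    intros n Hn; apply NNPP; eauto.
Qed.

Lemma free_partition : exists P : M, is_partition P k /\ has_card P w /\
  forall X, X ∈ P -> free F X.
Proof.
  destruct free_coloring as [C [HC [Htot [Huniq [Hfree Hsep]]]]].
  destruct (@colour_partition k C HC Htot Huniq) as [P [Hpart [HP Hcard]]].
  exists P; split; [auto|]; split; [split; [exact omega_cardinal|]|].
  - apply Hcard; intros HPfin.
    (* Each class contains at most one finite ordinal, so finitely many classes would leave only
       finitely many finite ordinals in [k]. *)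
    destruct (@separation finite k) as [A HA]; [dfn|].
    apply (finite_ordinals_infinite HA), (finite_class_set HA).
    apply finite_class_sub with (fun x => exists X, X ∈ P /\ (X ∈ P /\ x ∈ X /\ finite x)).
    + apply (@finite_class_union (fun X x => X ∈ P /\ x ∈ X /\ finite x)); [dfn|auto|].
      intros X _; apply finite_class_subsingleton.
      intros x y [HX [Hx Hfx]] [_ [Hy Hfy]].
      apply HP in HX as [n [_ [_ HX]]].
      apply HX in Hx as [Hx Hxn], Hy as [Hy Hyn]; apply (Hsep x y n); auto.
    + intros x [Hx Hfx]; destruct (proj2 (proj2 Hpart) x Hx) as [X [HX HxX]]; eauto 6.
  - intros X HX; apply HP in HX as [n [_ [_ HX]]].
    apply Hfree with n; intros z Hz; apply HX, Hz.
Qed.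

End FreeSets.

End SetTheory.

Theorem theorem1p6 (M : set_structure) (HZF : ZF M) (w : M) (Hw : is_omega w)
  (k : M) (Hk : is_cardinal k) (Hunc : uncountable k) :
  Free k w w /\ FreeUnion k w w.
Proof.
  split; intros F HF.
  - exact (free_omega HZF Hw (proj1 Hk) Hunc HF).
  - exact (free_partition HZF Hw (proj1 Hk) Hunc HF).
Qed.
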